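(* Let $n$ be a positive integer and let $\widehat G_{n,n}\subset\widehat G_n$ be the submanifold of symbols $L=\left(1+\sum_{i=1}^nu_iD^{-i}\right)D^n$, canonically identified with the affine subspace $\mathbb M_n\subset\Psi\mathbf D_q$ of operators $D^n+u_1D^{n-1}+\dots+u_n$. Under this identification the restriction to $\widehat G_{n,n}$ of the Poisson bracket on $\widehat G_n$ $$\{\varphi,\psi\}=\left\langle\left\langle \mathcal R_n\begin{pmatrix}\overline{\nabla\varphi}\\ \overline{\nabla'\varphi}\end{pmatrix},\begin{pmatrix}\overline{\nabla\psi}\\ \overline{\nabla'\psi}\end{pmatrix}\right\rangle\right\rangle$$ coincides with the Poisson bracket on $\mathbb M_n$ $$\{\varphi,\psi\}=\left\langle\left\langle \mathcal R_n\begin{pmatrix}\nabla\varphi\\ \nabla'\varphi\end{pmatrix},\begin{pmatrix}\nabla\psi\\ \nabla'\psi\end{pmatrix}\right\rangle\right\rangle,$$ where in both cases $$\mathcal R_n=\begin{pmatrix} r+\frac12\frac{1+\hat h^n}{1-\hat h^n}P_0' & -\frac{\hat h^n}{1-\hat h^n}P_0'+\frac12P_{00}\\[4pt] \frac{1}{1-\hat h^n}P_0'+\frac12P_{00} & r-\frac12\frac{1+\hat h^n}{1-\hat h^n}P_0'\end{pmatrix},\qquad r=\tfrac12(P_+-P_-).$$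
   Context: Fix $q\in\mathbb C$, $0<|q|<1$. $\mathbb C((z^{-1}))$ is the field of formal series $\sum_{i\le N}a_iz^i$; $(\hat hf)(z)=f(qz)$. $\Psi\mathbf D_q$ is the algebra of formal series $A=\sum_{i=-\infty}^{N}a_iD^i$, $a_i\in\mathbb C((z^{-1}))$, $D a=(\hat ha)D$. $J_+,J_0,J_-$ are the subspaces of series with only positive, zero, negative powers of $D$; $P_+,P_0,P_-$ are the corresponding projections. $\int a\,dz/z$ is the coefficient of $z^0$; $\operatorname{Tr}A=\int P_0A\,dz/z$; $\langle A,B\rangle=\operatorname{Tr}AB$; $P_{00}A=\operatorname{Tr}(A)\cdot1$, $P_0'=P_0-P_{00}$; $\langle\langle(X_1,X_2),(Y_1,Y_2)\rangle\rangle=\langle X_1,Y_1\rangle-\langle X_2,Y_2\rangle$. $\widehat G_n\subset\Psi\mathbf D_q$ is the set of series $L=D^n+\sum_{i\ge1}a_iD^{n-i}$. Write $L=\overline LD^n$. For a smooth functional $\varphi$ on $\widehat G_n$, $\overline{d\varphi}(L)\in\Psi\mathbf D_q$ satisfies $\langle\overline X,\overline{d\varphi}\rangle=\frac d{dt}|_{t=0}\varphi(L+t\overline XD^n)$ for all $\overline X\in J_-$ (it is defined modulo $J_-+J_0$, and the bracket is independent of the choice); $\overline{\nabla\varphi}=\overline L\,\overline{d\varphi}$, $\overline{\nabla'\varphi}=D^{-n}\,\overline{d\varphi}\,\overline L\,D^n$. For a functional $\varphi$ on $\mathbb M_n$, $d\varphi(L)\in\Psi\mathbf D_q$ is any element with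 $\langle d\varphi,X\rangle=\frac d{dt}|_{t=0}\varphi(L+tX)$ for $X$ tangent to $\mathbb M_n$ (the bracket is independent of the choice), $\nabla\varphi=L\,d\varphi$, $\nabla'\varphi=d\varphi\,L$. $\widehat G_{n,n}$ is a Poisson submanifold of $\widehat G_n$; the restriction of the bracket is obtained by extending functionals from $\widehat G_{n,n}$ to $\widehat G_n$, taking the bracket, and restricting. *)

(* Defs.v *)
From HB Require Import structures.
From mathcomp Require Import all_boot all_order all_algebra.
From mathcomp Require Import finmap complex zify.
From mathcomp Require Import all_classical all_reals all_analysis.

Set Implicit Arguments.
Unset Strict Implicit.
Unset Printing Implicit Defensive.

Import Order.TTheory GRing.Theory Num.Theory.
Import numFieldNormedType.Exports.

Local Open Scope classical_set_scope.
Local Open Scope complex_scope.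
Local Open Scope ring_scope.

(* Formal series sum_(i <= N) a_i X^i with a_i in A, as the functions int -> A
   vanishing above some N. With A := C and X := z this is C((z^-1)), and with
   A := C((z^-1)) and X := D it is the space of q-pseudodifference symbols. *)
Section DSeries.
Variable A : zmodType.

Definition bounded_above (a : int -> A) : Prop :=
  exists N : int, forall i, N < i -> a i = 0.

Record dseries := DSeries { coef :> int -> A; coefP : bounded_above coef }.

HB.instance Definition _ := gen_eqMixin dseries.
HB.instance Definition _ := gen_choiceMixin dseries.

Lemma dseriesP (a b : dseries) : (forall i, a i = b i) <-> a = b.
Proof.
split=> [|-> //]; case: a b => [a aP] [b bP] /= /funext ab.
by rewrite -ab in bP *; congr DSeries; exact: Prop_irrelevance.
Qed.

Lemma bounded_above0 : bounded_above (fun=> 0).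
Proof. by exists 0. Qed.

Lemma bounded_aboveN (a : dseries) : bounded_above (fun i => - a i).
Proof. by case: (coefP a) => N aN; exists N => i /aN ->; rewrite oppr0. Qed.

Lemma bounded_aboveD (a b : dseries) : bounded_above (fun i => a i + b i).
Proof.
case: (coefP a) (coefP b) => [N aN] [M bM]; exists (Num.max N M) => i.
by rewrite gt_max => /andP[/aN -> /bM ->]; rewrite addr0.
Qed.

Let dzero := DSeries bounded_above0.
Let dopp a := DSeries (bounded_aboveN a).
Let dadd a b := DSeries (bounded_aboveD a b).

Let daddA : associative dadd.
Proof. by move=> a b c; apply/dseriesP => i /=; rewrite addrA. Qed.
Let daddC : commutative dadd.
Proof. by move=> a b; apply/dseriesP => i /=; rewrite addrC. Qed.
Let dadd0 : left_id dzero dadd.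
Proof. by move=> a; apply/dseriesP => i /=; rewrite add0r. Qed.
Let daddN : left_inverse dzero dopp dadd.
Proof. by move=> a; apply/dseriesP => i /=; rewrite addNr. Qed.

HB.instance Definition _ :=
  GRing.isZmodule.Build dseries daddA daddC dadd0 daddN.

Lemma coef0 i : (0 : dseries) i = 0. Proof. by []. Qed.
Lemma coefN (a : dseries) i : (- a) i = - a i. Proof. by []. Qed.
Lemma coefD (a b : dseries) i : (a + b) i = a i + b i. Proof. by []. Qed.

Lemma bounded_above_monom (k : int) (x : A) :
  bounded_above (fun i => if i == k then x else 0).
Proof. by exists k => i ki; rewrite gt_eqF. Qed.

(* x X^k *)
Definition monom (k : int) (x : A) : dseries :=
  DSeries (bounded_above_monom k x).

Lemma bounded_above_restr (P : pred int) (a : dseries) :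
  bounded_above (fun i => if P i then a i else 0).
Proof. by case: (coefP a) => N aN; exists N => i /aN ->; case: ifP. Qed.

(* sum over the i with P i of a_i X^i *)
Definition restr (P : pred int) (a : dseries) : dseries :=
  DSeries (bounded_above_restr P a).

End DSeries.

Section DSeriesMap.
Variables A B : zmodType.

Lemma bounded_above_map (f : int -> {additive A -> B}) (a : dseries A) :
  bounded_above (fun i => f i (a i)).
Proof. by case: (coefP a) => N aN; exists N => i /aN ->; rewrite raddf0. Qed.

(* sum_i f_i(a_i) X^i *)
Definition dmap (f : int -> {additive A -> B}) (a : dseries A) : dseries B :=
  DSeries (bounded_above_map f a).

Lemma dmap_is_zmod_morphism f : zmod_morphism (dmap f).
Proof. by move=> a b; apply/dseriesP => i; rewrite /= !raddfB. Qed.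

HB.instance Definition _ f :=
  GRing.isZmodMorphism.Build (dseries A) (dseries B) (dmap f)
    (dmap_is_zmod_morphism f).

End DSeriesMap.

(* A Cauchy product has only finitely many nonzero terms in each degree. *)
Lemma bounded_above_conv (A : nzRingType) (s : int -> {additive A -> A})
    (a b : dseries A) :
  bounded_above (fun k => \sum_(i \in [set: int]) a i * s i (b (k - i))).
Proof.
case: (coefP a) (coefP b) => [N aN] [M bM]; exists (N + M) => k NMk.
apply: fsbig1 => i _; case: (ltP N i) => [/aN ->|iN]; first by rewrite mul0r.
by rewrite bM ?raddf0 ?mulr0// ltrBrDr (le_lt_trans _ NMk)// addrC lerD2r.
Qed.


Section Laurent.
Variable R : realType.
Local Notation C := R[i].

(* C((z^-1)) *)
Definition laurent := dseries C.
HB.instance Definition _ := GRing.Zmodule.on laurent.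

Let lone : laurent := monom 0 1.
Let lmul (a b : laurent) : laurent :=
  DSeries (bounded_above_conv (fun=> idfun) a b).

(* To exchange or add the finitely supported sums over int below, they are
   first rewritten as sums over a common finite set. *)
Let int_interval (lo hi : int) :
  exists s : {fset int}, forall i, lo <= i <= hi -> i \in s.
Proof.
exists [fset (lo + m%:Z)%R | m in iota 0 `|hi - lo|.+1]%fset => i /andP[li ih].
apply/imfsetP; exists `|i - lo|%N => /=; last by lia.
by rewrite inE mem_iota; lia.
Qed.

Let lmulC : commutative lmul.
Proof.
move=> a b; apply/dseriesP => k /=.
rewrite (@reindex_fsbigT _ _ _ _ _ (fun i => k - i)) /=; last first.
  by exists (fun i => k - i) => i; rewrite subKr.
by apply: eq_fsbigr => i _; rewrite subKr mulrC.
Qed.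

Let lmul1 : left_id lone lmul.
Proof.
move=> a; apply/dseriesP => k /=.
rewrite (@fsbigTE _ _ _ _ [fset 0%R]%fset) /=.
  by rewrite big_seq_fset1 eqxx mul1r subr0.
by move=> i; rewrite inE => /negPf ->; rewrite mul0r.
Qed.

Let lmulA : associative lmul.
Proof.
move=> a b c; apply/dseriesP => k /=.
case: (coefP a) (coefP b) (coefP c) => [N aN] [M bM] [P cP].
have [s sP] := int_interval (Num.min (k - P) (k - P - M)) (Num.max N (N + M)).
under eq_fsbigr do rewrite mulr_fsumr.
under [RHS]eq_fsbigr do rewrite mulr_fsuml.
transitivity (\sum_(i \in [set: int]) \sum_(j \in [set: int])
    a i * (b (j - i) * c (k - j))).
  apply: eq_fsbigr => i _.
  rewrite (@reindex_fsbigT _ _ _ _ _ (fun j => j - i)) /=; last first.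
    by exists (fun j => j + i) => j; rewrite ?addrK ?subrK.
  by apply: eq_fsbigr => j _; rewrite opprB addrA subrK.
have supp i j : a i * (b (j - i) * c (k - j)) != 0 -> (i \in s) && (j \in s).
  rewrite !mulf_eq0 !negb_or => /and3P[ai bj ck].
  have iN : i <= N by rewrite leNgt; apply: contra ai => /aN ->.
  have jM : j - i <= M by rewrite leNgt; apply: contra bj => /bM ->.
  have kP : k - j <= P by rewrite leNgt; apply: contra ck => /cP ->.
  apply/andP; split; apply: sP; rewrite ge_min le_max; lia.
rewrite (@fsbigTE _ _ _ _ s); last first.
  move=> i si; apply: fsbig1 => j _; apply/eqP; apply: contraNT si.
  by move=> /supp/andP[].
under eq_bigr => i _.
  rewrite (@fsbigTE _ _ _ _ s); last first.
    by move=> j sj; apply/eqP; apply: contraNT sj => /supp/andP[].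
  over.
rewrite exchange_big /= [RHS](@fsbigTE _ _ _ _ s); last first.
  move=> j sj; apply: fsbig1 => i _; apply/eqP; apply: contraNT sj.
  by rewrite -mulrA => /supp/andP[].
apply: eq_bigr => j _; rewrite [RHS](@fsbigTE _ _ _ _ s); last first.
  by move=> i si; apply/eqP; apply: contraNT si; rewrite -mulrA => /supp/andP[].
by apply: eq_bigr => i _; rewrite mulrA.
Qed.

Let lmulDl : left_distributive lmul +%R.
Proof.
move=> a b c; apply/dseriesP => k /=.
case: (coefP a) (coefP b) (coefP c) => [N aN] [M bM] [P cP].
have [s sP] := int_interval (k - P) (Num.max N M).
have supp i : i \notin s -> (c (k - i) = 0) \/ (a i = 0 /\ b i = 0).
  move=> si; case: (ltP P (k - i)) => [/cP|kP]; first by left.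
  right; suff: Num.max N M < i by rewrite gt_max => /andP[/aN ? /bM ?].
  by rewrite ltNge; apply: contra si => iN; apply: sP; rewrite iN andbT; lia.
have fin (f : int -> C) : (forall i, i \notin s -> f i = 0) ->
  \sum_(i \in [set: int]) f i = \sum_(i <- s) f i by exact: fsbigTE.
rewrite !fin => [|i|i|i]; first last.
- by case/supp => [ci|[ai bi]]; rewrite /= ?ci ?ai ?bi ?addr0 ?mulr0 ?mul0r.
- by case/supp => [ci|[ai bi]]; rewrite /= ?ci ?ai ?mulr0 ?mul0r.
- by case/supp => [ci|[ai bi]]; rewrite /= ?ci ?bi ?mulr0 ?mul0r.
by rewrite -big_split; apply: eq_bigr => i _; rewrite mulrDl.
Qed.

Let lone_neq0 : lone != 0.
Proof. by apply/eqP => /dseriesP/(_ 0)/eqP; rewrite /= oner_eq0. Qed.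

HB.instance Definition _ := GRing.Zmodule_isComNzRing.Build laurent
  lmulA lmulC lmul1 lmulDl lone_neq0.

Lemma laurentM (a b : laurent) k :
  (a * b) k = \sum_(i \in [set: int]) a i * b (k - i).
Proof. by []. Qed.

End Laurent.

Section PseudoDifference.
Variable R : realType.
Local Notation C := R[i].
Local Notation laurent := (laurent R).

(* The diagonal operator sum_k a_k z^k |-> sum_k w(k) a_k z^k. *)
Definition lscale (w : int -> C) (a : laurent) : laurent :=
  dmap (fun k => w k \*o idfun) a.

Fact lscale_is_zmod_morphism w : zmod_morphism (lscale w).
Proof. exact: raddfB. Qed.
HB.instance Definition _ w :=
  GRing.isZmodMorphism.Build laurent laurent (lscale w)
    (lscale_is_zmod_morphism w).

(* (hhat q f)(z) = f(q z); its powers are hhat (q ^ j), j : int. *)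
Definition hhat (q : C) : laurent -> laurent := lscale (fun k => q ^ k).
HB.instance Definition _ q := GRing.Additive.on (hhat q).

(* For a function f, the operator f(hhat^n), where z^k is an eigenvector of
   hhat^n for the eigenvalue q^(n k). *)
Definition hfun (q : C) (n : nat) (f : C -> C) : laurent -> laurent :=
  lscale (fun k => f ((q ^+ n) ^ k)).
HB.instance Definition _ q n f := GRing.Additive.on (hfun q n f).

Lemma hfun_inv (q : C) (n : nat) (a : laurent) :
  0 < `|q| -> `|q| < 1 -> (0 < n)%N -> a 0 = 0 ->
  let b := hfun q n (fun x => 1 / (1 - x)) a in b - hhat (q ^ n) b = a.
Proof.
move=> q_gt0 q_lt1 n_gt0 a0; apply/dseriesP => k /=.
rewrite -exprnP; set x := _ ^ k.
have [->|k_neq0] := eqVneq k 0; first by rewrite a0 !mulr0 subr0.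
rewrite -[X in X - _]mul1r -mulrBl mulrA mulrCA mul1r mulfV ?mulr1 ?mul1r//.
rewrite subr_eq0 eq_sym; apply/eqP => x1.
have pn_lt1 m : `|(q ^+ n) ^+ m.+1| < 1.
  by rewrite -exprM normrX exprn_ilt1// ?muln_eq0 ?negb_or -?lt0n ?n_gt0// ltW.
case: k k_neq0 @x x1 => [[|m]|m] //= _.
  by rewrite -exprnP => x1; move: (pn_lt1 m); rewrite x1 normr1 ltxx.
rewrite NegzE -exprnN => x1; move: (pn_lt1 m).
by rewrite -[_ ^+ m.+1]invrK x1 invr1 normr1 ltxx.
Qed.

(* The symbols sum_(i <= N) a_i D^i; the product, which depends on q, is psmul. *)
Definition psd := dseries laurent.
HB.instance Definition _ := GRing.Zmodule.on psd.

(* The product determined by D a = (hhat a) D: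
   (a D^i) (b D^j) = a (hhat^i b) D^(i + j). *)
Definition psmul (q : C) (A B : psd) : psd :=
  DSeries (bounded_above_conv (fun i => hhat (q ^ i)) A B).

Lemma psmulE q (A B : psd) k :
  psmul q A B k = \sum_(i \in [set: int]) A i * hhat (q ^ i) (B (k - i)).
Proof. by []. Qed.

Lemma psmul_monom q i j (a b : laurent) :
  psmul q (monom i a) (monom j b) = monom (i + j) (a * hhat (q ^ i) b).
Proof.
apply/dseriesP => k; rewrite psmulE (@fsbigTE _ _ _ _ [fset i]%fset) /=.
  by rewrite big_seq_fset1 eqxx subr_eq addrC; case: ifP; rewrite ?raddf0 ?mulr0.
by move=> l; rewrite inE => /negPf ->; rewrite mul0r.
Qed.

Definition psscale (c : C) (A : psd) : psd :=
  dmap (fun=> lscale (fun=> c)) A.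

Definition Dpow (k : int) : psd := monom k 1.

Definition psone : psd := Dpow 0.

Definition Pplus : psd -> psd := restr (fun i => 0 < i).
Definition Pzero : psd -> psd := restr (fun i => i == 0).
Definition Pminus : psd -> psd := restr (fun i => i < 0).

Definition Jminus : set psd := [set A | forall i, 0 <= i -> A i = 0].

(* int a dz/z *)
Definition lint (a : laurent) : C := a 0.

Definition Tr (A : psd) : C := lint (Pzero A 0).

Definition pairing (q : C) (A B : psd) : C := Tr (psmul q A B).

Definition pairing2 (q : C) (X Y : psd * psd) : C :=
  pairing q X.1 Y.1 - pairing q X.2 Y.2.

Definition Pzz (A : psd) : psd := psscale (Tr A) psone.
Definition Pzero' (A : psd) : psd := Pzero A - Pzz A.

Definition hfun0' (q : C) (n : nat) (f : C -> C) (A : psd) : psd :=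
  dmap (fun=> hfun q n f) (Pzero' A).

Definition rmx (A : psd) : psd := psscale (1 / 2) (Pplus A - Pminus A).

(* On the image of Pzero' the eigenvalues of hhat^n are the q^(n k) with
   k <> 0, which are different from 1 when 0 < |q| < 1 and 0 < n, so that the
   fractions below are the honest ones. *)
Definition Rmx (q : C) (n : nat) (X : psd * psd) : psd * psd :=
  ((rmx X.1 + psscale (1 / 2) (hfun0' q n (fun x => (1 + x) / (1 - x)) X.1))
   + (- hfun0' q n (fun x => x / (1 - x)) X.2 + psscale (1 / 2) (Pzz X.2)),
   (hfun0' q n (fun x => 1 / (1 - x)) X.1 + psscale (1 / 2) (Pzz X.1))
   + (rmx X.2 - psscale (1 / 2) (hfun0' q n (fun x => (1 + x) / (1 - x)) X.2))).

(* The symbols L = D^n + sum_(i >= 1) a_i D^(n-i). *)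
Definition Ghat (n : nat) : set psd :=
  [set L | L n%:Z = 1 /\ forall i, n%:Z < i -> L i = 0].

(* L = Lbar D^n *)
Definition Lbar (q : C) (n : nat) (L : psd) : psd := psmul q L (Dpow (- n%:Z)).

(* The coefficients (u_1, ..., u_n) are indexed from 0: u_(i+1) is u i. *)
Definition Gsymbol (q : C) (n : nat) (u : 'I_n -> laurent) : psd :=
  psmul q (psone + \sum_(i < n) monom (- i.+1%:Z) (u i)) (Dpow n%:Z).

Definition Moperator (n : nat) (u : 'I_n -> laurent) : psd :=
  Dpow n%:Z + \sum_(i < n) monom (n%:Z - i.+1%:Z) (u i).

Definition Mset (n : nat) : set psd := range (@Moperator n).

Definition Mtangent (n : nat) : set psd :=
  [set X | exists u : 'I_n -> laurent,
             X = \sum_(i < n) monom (n%:Z - i.+1%:Z) (u i)].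

(* d/dt f(t) at t = 0 exists and equals l, for f complex-valued, t real. *)
Definition derivative_at0 (f : R -> C) (l : C) : Prop :=
  is_derive (0 : R) (1 : R) (fun t => complex.Re (f t)) (complex.Re l) /\
  is_derive (0 : R) (1 : R) (fun t => complex.Im (f t)) (complex.Im l).

(* Functionals on Ghat n and on Mset n are represented by functions on psd;
   below they are only evaluated at points of Ghat n, resp. Mset n. *)

Definition is_gradG (q : C) (n : nat) (phi : psd -> C) (L dphi : psd) : Prop :=
  forall X, Jminus X ->
    derivative_at0
      (fun t : R => phi (L + psscale t%:C (psmul q X (Dpow n%:Z))))
      (pairing q X dphi).

Definition smoothG (q : C) (n : nat) (phi : psd -> C) : Prop :=
  forall L, Ghat n L -> exists dphi, is_gradG q n phi L dphi.

Definition is_gradM (q : C) (n : nat) (phi : psd -> C) (L dphi : psd) : Prop :=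
  forall X, Mtangent n X ->
    derivative_at0 (fun t : R => phi (L + psscale t%:C X)) (pairing q dphi X).

Definition smoothM (q : C) (n : nat) (phi : psd -> C) : Prop :=
  forall L, Mset n L -> exists dphi, is_gradM q n phi L dphi.

(* The values at L of the two brackets, in terms of differentials dphi, dpsi of
   phi, psi at L. *)

Definition gradsG (q : C) (n : nat) (L dphi : psd) : psd * psd :=
  (psmul q (Lbar q n L) dphi,
   psmul q (psmul q (psmul q (Dpow (- n%:Z)) dphi) (Lbar q n L)) (Dpow n%:Z)).

Definition bracketG (q : C) (n : nat) (L dphi dpsi : psd) : C :=
  pairing2 q (Rmx q n (gradsG q n L dphi)) (gradsG q n L dpsi).

Definition gradsM (q : C) (L dphi : psd) : psd * psd :=
  (psmul q L dphi, psmul q dphi L).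

Definition bracketM (q : C) (n : nat) (L dphi dpsi : psd) : C :=
  pairing2 q (Rmx q n (gradsM q L dphi)) (gradsM q L dpsi).

(* Phi on Ghat n restricts to phi on M_n. *)
Definition extends (q : C) (n : nat) (Phi phi : psd -> C) : Prop :=
  forall u : 'I_n -> laurent, Phi (Gsymbol q u) = phi (Moperator u).

End PseudoDifference.

(* Main.v *)
Require Import Defs.
From HB Require Import structures.
From mathcomp Require Import all_boot all_order all_algebra.
From mathcomp Require Import finmap complex zify ring.
From mathcomp Require Import all_classical all_reals all_analysis.

Set Implicit Arguments.
Unset Strict Implicit.
Unset Printing Implicit Defensive.

Import Order.TTheory GRing.Theory Num.Theory.

Local Open Scope ring_scope.

(** Write M for the affine space of operators of order n. If d is a differential
of an extension Phi at L in M, then the gradients of Phi at L are L d' and d' L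
with d' = D^(- n) d ([gradsGE]). Hence the bracket on symbols, computed from d
and e, is the bracket on operators computed from D^(- n) d and D^(- n) e, and it
remains to see that these may be replaced by the differentials of the given
functionals on M.

Since Phi extends phi, D^(- n) d and a differential of phi have the same pairing
with every vector tangent to M. As the trace form is symmetric and nondegenerate,
they agree in the degrees from - n + 1 to 0 ([grad_agree]). It is therefore
enough that the bracket on operators depends on these coefficients only
([bracketM_eq]). The matrix R_n is skew for the doubled form ([Rmx_skew]), which
reduces this to the first argument, and for the pair (L Z, Z L) there are two
cases. If Z is in J_+, both components are in J_+ and the matrix acts as 1/2
([bracketM_positive]). If Z has order at most - n, the terms of degree 0 of L Z
and Z L are hhat^n w and w, and the fractions in hhat^n are such that the matrix
acts as - 1/2, up to a multiple of (1, 1) ([bracketM_low]). In both cases the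
pairing with (L B, B L) is zero, because Tr L Z L B = Tr Z L B L and
Tr L B = Tr B L.

The calculus behind this is the associativity of the product ([psmulA]) and the
symmetry of the trace form ([pairingC]). Every smooth functional on M does have
a smooth extension, obtained by forgetting the negative powers of D
([nonneg_part_smooth]). *)

(** * Finitely supported sums over the integers *)

Lemma int_interval (lo hi : int) :
  exists s : {fset int}, forall i, lo <= i <= hi -> i \in s.
Proof.
exists [fset (lo + m%:Z)%R | m in iota 0 `|hi - lo|.+1]%fset => i /andP[li ih].
apply/imfsetP; exists `|i - lo|%N => /=; last by lia.
by rewrite inE mem_iota; lia.
Qed.

Lemma coef_sum (A : zmodType) (I : Type) (r : seq I) (P : pred I)
    (F : I -> dseries A) k :
  (\sum_(i <- r | P i) F i) k = \sum_(i <- r | P i) F i k.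
Proof.
by apply: (big_ind2 (fun (x : dseries A) y => x k = y)) => // x _ y _ <- <-.
Qed.

(** A Cauchy product is, in each degree, a sum over a finite set of indices;
    two products are compared over the union of their sets. *)
Lemma conv_support (A B : zmodType) (a : dseries A) (b : dseries B) (k : int) :
  exists s : {fset int}, forall i, i \notin s -> a i = 0 \/ b (k - i) = 0.
Proof.
case: (coefP a) (coefP b) => [N aN] [M bM]; have [s sP] := int_interval (k - M) N.
exists s => i si; case: (ltP N i) => [/aN|iN]; first by left.
right; apply: bM; rewrite ltNge; apply: contra si => kiM.
by apply: sP; rewrite iN andbT; lia.
Qed.

(** * The algebra of q-pseudodifference symbols *)

Section Algebra.
Variable R : realType.
Local Notation C := R[i].
Local Notation laurent := (laurent R).
Local Notation psd := (psd R).

Lemma pcoefD (A B : psd) i : (A + B) i = A i + B i. Proof. by []. Qed.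
Lemma pcoefN (A : psd) i : (- A) i = - A i. Proof. by []. Qed.

Lemma lint_mul (a b : laurent) :
  lint (a * b) = \sum_(i \in [set: int]) a i * b (- i).
Proof.
by rewrite /lint laurentM; apply: eq_fsbigr => i _; rewrite sub0r.
Qed.

(** The coefficient of z^0 in a product pairs z^k with z^(- k), so that the
    adjoint of a diagonal operator has the reflected weights. *)
Lemma lint_lscale_adj (w : int -> C) (a b : laurent) :
  lint (lscale w a * b) = lint (a * lscale (fun k => w (- k)) b).
Proof.
rewrite !lint_mul; apply: eq_fsbigr => i _ /=.
by rewrite opprK mulrAC mulrCA mulrA mulrAC mulrC mulrA.
Qed.

Lemma lint_hhat (w : C) (a : laurent) : lint (hhat w a) = lint a.
Proof. by rewrite /lint /= expr0z mul1r. Qed.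

Lemma hhat1 (w : C) : hhat w 1 = 1 :> laurent.
Proof.
apply/dseriesP => k /=.
by case: eqP => [->|_]; rewrite ?expr0z ?mulr1 ?mulr0.
Qed.

Lemma hhat_id (a : laurent) : hhat 1 a = a.
Proof. by apply/dseriesP => k /=; rewrite exp1rz mul1r. Qed.

Lemma hhatM (w : C) (a b : laurent) : w != 0 ->
  hhat w (a * b) = hhat w a * hhat w b.
Proof.
move=> w_neq0; apply/dseriesP => k.
have [s sP] := conv_support a b k.
rewrite laurentM /= !(@fsbigTE _ _ _ _ s) => [|i si|i si].
- rewrite mulr_sumr; apply: eq_bigr => i _.
  rewrite mulrACA -expfzDr//; congr (w ^ _ * _); lia.
- by case: (sP i si) => -> /=; rewrite !(mulr0, mul0r).
- by case: (sP i si) => -> /=; rewrite !(mulr0, mul0r).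
Qed.

Lemma hhat_comp (w w' : C) (a : laurent) :
  hhat w (hhat w' a) = hhat (w * w') a.
Proof. by apply/dseriesP => k /=; rewrite mulrA expfzMl. Qed.

Section Product.
Variable q : C.
Hypothesis q_neq0 : q != 0.
Local Notation "A ** B" := (psmul q A B) (at level 40, left associativity).

Let hhat_expz i j (a : laurent) :
  hhat (q ^ i) (hhat (q ^ j) a) = hhat (q ^ (i + j)) a.
Proof. by rewrite hhat_comp expfzDr. Qed.

Lemma psmul_zmod_morphism A : zmod_morphism (psmul q A).
Proof.
move=> B B'; apply/dseriesP => k; rewrite pcoefD pcoefN !psmulE.
have [s sP] := conv_support A B k; have [s' s'P] := conv_support A B' k.
rewrite !(@fsbigTE _ _ _ _ (s `|` s')%fset) => [|i|i|i].
- by rewrite -sumrB; apply: eq_bigr => i _; rewrite -mulrBr -raddfB.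
all: rewrite inE negb_or => /andP[/(sP i) sPi /(s'P i)].
- by case=> ->; rewrite ?mul0r ?raddf0 ?mulr0.
- by case: sPi => ->; rewrite ?mul0r ?raddf0 ?mulr0.
- case=> [->|]; rewrite ?mul0r// pcoefD pcoefN => ->.
  by case: sPi => ->; rewrite ?mul0r ?subr0 ?raddf0 ?mulr0.
Qed.
HB.instance Definition _ A :=
  GRing.isZmodMorphism.Build psd psd (psmul q A) (psmul_zmod_morphism A).

Lemma psmulDr A B B' : A ** (B + B') = A ** B + A ** B'.
Proof. exact: raddfD. Qed.

Lemma psmulDl A A' B : (A + A') ** B = A ** B + A' ** B.
Proof.
apply/dseriesP => k; rewrite pcoefD !psmulE.
have [s sP] := conv_support A B k; have [s' s'P] := conv_support A' B k.
rewrite !(@fsbigTE _ _ _ _ (s `|` s')%fset) => [|i|i|i].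
- by rewrite -big_split; apply: eq_bigr => i _; exact: mulrDl.
all: rewrite inE negb_or => /andP[/(sP i) sPi /(s'P i)].
- by case=> ->; rewrite ?mul0r ?raddf0 ?mulr0.
- by case: sPi => ->; rewrite ?mul0r ?raddf0 ?mulr0.
- case=> [|->]; last by rewrite ?raddf0 ?mulr0.
  by rewrite pcoefD => ->; case: sPi => ->; rewrite ?addr0 ?mul0r ?raddf0 ?mulr0.
Qed.

Lemma psmul_monoml m a B k : (monom m a ** B) k = a * hhat (q ^ m) (B (k - m)).
Proof.
rewrite psmulE (@fsbigTE _ _ _ _ [fset m]%fset) ?big_seq_fset1 /= ?eqxx//.
by move=> i; rewrite inE => /negPf ->; rewrite mul0r.
Qed.

Lemma psmul_monomr A m b k :
  (A ** monom m b) k = A (k - m) * hhat (q ^ (k - m)) b.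
Proof.
rewrite psmulE (@fsbigTE _ _ _ _ [fset (k - m)%R]%fset).
  by rewrite big_seq_fset1 /= subKr eqxx.
move=> i; rewrite inE /= => ikm; rewrite ifF ?raddf0 ?mulr0//.
by apply: contraNF ikm => /eqP <-; rewrite subKr.
Qed.

Lemma psmul_Dpowr A m k : (A ** Dpow R m) k = A (k - m).
Proof. by rewrite psmul_monomr hhat1 mulr1. Qed.

Lemma psmul_Dpowl B m k : (Dpow R m ** B) k = hhat (q ^ m) (B (k - m)).
Proof. by rewrite psmul_monoml mul1r. Qed.

Lemma ps1mul A : psone R ** A = A.
Proof. by apply/dseriesP => k; rewrite psmul_Dpowl subr0 hhat_id. Qed.

(** In both bracketings the coefficient of D^k is the double sum of
    A_i (hhat^i B_(j-i)) (hhat^j E_(k-j)), in which i and j range over a common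
    bounded set of integers. *)
Lemma psmulA A B E : A ** (B ** E) = A ** B ** E.
Proof.
apply/dseriesP => k; case: (coefP A) (coefP B) (coefP E) => [N AN] [M BM] [P EP].
have [s sP] := int_interval (Num.min (k - P) (k - P - M)) (Num.max N (N + M)).
pose F i j := A i * hhat (q ^ i) (B (j - i)) * hhat (q ^ j) (E (k - j)).
have FR : (A ** B ** E) k = \sum_(j <- s) \sum_(i <- s) F i j.
  rewrite psmulE (@fsbigTE _ _ _ _ s) => [|j sj].
    apply: eq_bigr => j _; case: (ltP P (k - j)) => [/EP Ej|kP].
      rewrite Ej raddf0 mulr0 big1// => i _.
      by rewrite /F Ej raddf0 mulr0.
    rewrite psmulE (@fsbigTE _ _ _ _ s) ?mulr_suml// => i si.
    case: (ltP N i) => [/AN ->|iN]; first by rewrite mul0r.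
    rewrite BM ?raddf0 ?mulr0// ltNge; apply: contra si => jM.
    by apply: sP; rewrite ge_min le_max; lia.
  case: (ltP P (k - j)) => [/EP ->|kP]; first by rewrite raddf0 mulr0.
  rewrite psmulE fsbig1 ?mul0r// => i _.
  case: (ltP N i) => [/AN ->|iN]; first by rewrite mul0r.
  rewrite BM ?raddf0 ?mulr0// ltNge; apply: contra sj => jM.
  by apply: sP; rewrite ge_min le_max; lia.
rewrite FR exchange_big psmulE (@fsbigTE _ _ _ _ s) => [|i si].
  apply: eq_bigr => i _; case: (ltP N i) => [/AN Ai|iN].
    by rewrite Ai mul0r big1// => j _; rewrite /F Ai !mul0r.
  rewrite psmulE (@reindex_fsbigT _ _ _ _ _ (fun j => j - i)) /=; last first.
    by exists (fun j => j + i) => j; rewrite ?addrK ?subrK.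
  rewrite (@fsbigTE _ _ _ _ s) => [|j sj].
    rewrite raddf_sum mulr_sumr; apply: eq_bigr => j _.
    have -> : k - i - (j - i) = k - j by lia.
    rewrite -[X in _ * X]/(hhat (q ^ i) (B (j - i) * hhat (q ^ (j - i)) _)).
    by rewrite hhatM ?expfz_neq0// hhat_expz subrKC mulrA.
  have -> : k - i - (j - i) = k - j by lia.
  case: (ltP M (j - i)) => [/BM ->|jM]; first by rewrite mul0r.
  rewrite EP ?raddf0 ?mulr0// ltNge; apply: contra sj => kP.
  by apply: sP; rewrite ge_min le_max; lia.
case: (ltP N i) => [/AN ->|iN]; first by rewrite mul0r.
rewrite psmulE fsbig1 ?raddf0 ?mulr0// => j _.
case: (ltP M j) => [/BM ->|jM]; first by rewrite mul0r.
rewrite EP ?raddf0 ?mulr0// ltNge; apply: contra si => kP.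
by apply: sP; rewrite ge_min le_max; lia.
Qed.

End Product.
End Algebra.

(** * The trace form *)

Section Trace.
Variable R : realType.
Local Notation C := R[i].
Local Notation laurent := (laurent R).
Local Notation psd := (psd R).
Variable q : C.
Hypothesis q_neq0 : q != 0.
Local Notation "A ** B" := (psmul q A B) (at level 40, left associativity).

Lemma TrE (A : psd) : Tr A = lint (A 0). Proof. by []. Qed.

Lemma pairingE (A B : psd) :
  pairing q A B = \sum_(i \in [set: int]) lint (A i * hhat (q ^ i) (B (- i))).
Proof.
rewrite /pairing TrE psmulE; have [s sP] := conv_support A B 0.
have supp i : i \notin s -> A i * hhat (q ^ i) (B (0 - i)) = 0.
  by move=> /(sP _)[] ->; rewrite ?mul0r ?raddf0 ?mulr0.
rewrite (@fsbigTE _ _ _ _ s)// [RHS](@fsbigTE _ _ _ _ s) => [|i /supp].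
  by rewrite [LHS]coef_sum; apply: eq_bigr => i _; rewrite sub0r.
by rewrite sub0r => ->.
Qed.

Lemma pairing_monom m a B :
  pairing q (monom m a) B = lint (a * hhat (q ^ m) (B (- m))).
Proof. by rewrite /pairing TrE psmul_monoml sub0r. Qed.

(** The terms of Tr AB and of Tr BA correspond under i to - i, up to a power of
    hhat, which the residue does not see. *)
Lemma pairingC A B : pairing q A B = pairing q B A.
Proof.
rewrite !pairingE (@reindex_fsbigT _ _ _ _ _ -%R); last first.
  by exists -%R => i; rewrite opprK.
apply: eq_fsbigr => i _; rewrite opprK -(lint_hhat (q ^ i)).
by rewrite hhatM ?expfz_neq0// hhat_comp -expfzDr// subrr expr0z hhat_id mulrC.
Qed.

Lemma pairingDr A B B' : pairing q A (B + B') = pairing q A B + pairing q A B'.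
Proof. by rewrite /pairing psmulDr. Qed.

Lemma pairingNr A B : pairing q A (- B) = - pairing q A B.
Proof. by rewrite /pairing raddfN. Qed.

Lemma pairingZr c A B : pairing q A (psscale c B) = c * pairing q A B.
Proof.
rewrite pairingC [in RHS]pairingC !pairingE mulr_fsumr.
apply: eq_fsbigr => i _; rewrite !lint_mul mulr_fsumr.
by apply: eq_fsbigr => j _; rewrite [RHS]mulrA.
Qed.

Lemma pairingDl A A' B : pairing q (A + A') B = pairing q A B + pairing q A' B.
Proof. by rewrite !(pairingC _ B) pairingDr. Qed.

Lemma pairingNl A B : pairing q (- A) B = - pairing q A B.
Proof. by rewrite !(pairingC _ B) pairingNr. Qed.

Lemma pairingZl c A B : pairing q (psscale c A) B = c * pairing q A B.
Proof. by rewrite !(pairingC _ B) pairingZr. Qed.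

Definition pairing_lin :=
  (pairingDl, pairingDr, pairingNl, pairingNr, pairingZl, pairingZr).

Lemma pairingA A B E : pairing q (A ** B) E = pairing q A (B ** E).
Proof. by rewrite /pairing psmulA. Qed.

Lemma pairing_cycle A B E : pairing q (A ** B) E = pairing q (B ** E) A.
Proof. by rewrite pairingA pairingC. Qed.

(** Only opposite degrees are paired, so that in particular P_+ and P_- are
    adjoint to each other. *)
Lemma pairing_restr (P : pred int) A B :
  pairing q (restr P A) B = pairing q A (restr (fun i => P (- i)) B).
Proof.
rewrite !pairingE; apply: eq_fsbigr => i _.
rewrite [restr _ _ i]/= [restr _ _ (- i)]/= opprK.
by case: ifP => // _; rewrite raddf0 mulr0 mul0r.
Qed.

(** The form is nondegenerate in each degree: the coefficient of z^k D^i in Z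
    is the pairing of Z with a multiple of D^(- i) z^(- k). *)
Lemma pairing_nondegenerate (Z : psd) (i : int) :
  (forall a : laurent, pairing q Z (monom (- i) a) = 0) -> Z i = 0.
Proof.
move=> Z0; apply/dseriesP => k.
have := Z0 (hhat (q ^ (- i)) (monom (- k) 1)).
rewrite pairingC pairing_monom opprK -hhatM ?expfz_neq0// lint_hhat lint_mul.
rewrite (@fsbigTE _ _ _ _ [fset (- k)%R]%fset) ?big_seq_fset1 /=.
  by rewrite eqxx opprK mul1r.
by move=> j; rewrite inE => /negPf ->; rewrite mul0r.
Qed.

End Trace.

(** * The R-matrix *)

Section RMatrix.
Variable R : realType.
Local Notation C := R[i].
Local Notation laurent := (laurent R).
Local Notation psd := (psd R).
Variables (q : C) (n : nat).
Hypotheses (q_gt0 : 0 < `|q|) (q_lt1 : `|q| < 1) (n_gt0 : (0 < n)%N).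

Let q_neq0 : q != 0. Proof. by rewrite -normr_gt0. Qed.

(* At z^k the inversion formula for 1 - hhat^n would read 0 = 1 if the
   eigenvalue were 1. *)
Let one_sub_eigenvalue (k : int) : k != 0 -> 1 - (q ^+ n) ^ k != 0.
Proof.
move=> k_neq0; have a0 : (monom k 1 : laurent) 0 = 0.
  by rewrite /= eq_sym (negPf k_neq0).
have /dseriesP/(_ k) := hfun_inv q_gt0 q_lt1 n_gt0 a0.
rewrite /= eqxx -exprnP mulr1 => e; apply/eqP => x1.
by move/eqP: e; rewrite x1 invr0 !mulr0 subr0 eq_sym oner_eq0.
Qed.

(** The weight at k = 0, where f would be taken at 1, is 0: P_0' removes the
    constant term. *)
Lemma hfun0'E f (A : psd) : hfun0' q n f A =
  monom 0 (lscale (fun k => if k == 0 then 0 else f ((q ^+ n) ^ k)) (A 0)).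
Proof.
apply/dseriesP => i; apply/dseriesP => k /=.
rewrite TrE /lint; case: (eqVneq i 0) => [->|_] /=.
  case: (eqVneq k 0) => [->|_]; last by rewrite mulr0 subr0.
  by rewrite mulr1 subrr mulr0 mul0r.
by rewrite mulr0 subr0 mulr0.
Qed.

Lemma hfun0'_adj f g (X Y : psd) :
  (forall x, x != 0 -> 1 - x != 0 -> f x^-1 = - g x) ->
  pairing q (hfun0' q n f X) Y = - pairing q X (hfun0' q n g Y).
Proof.
move=> fg; rewrite -pairingNr//.
have -> : - hfun0' q n g Y = hfun0' q n (fun x => - g x) Y.
  by apply/dseriesP => i; apply/dseriesP => k; rewrite [RHS]mulNr.
rewrite [RHS]pairingC// !hfun0'E !pairing_monom !expr0z !oppr0 !hhat_id.
rewrite lint_lscale_adj [LHS](congr1 _ (mulrC _ _)).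
set v := lscale _ _; set w := lscale _ _; suff -> : v = w by [].
apply/dseriesP => k /=; rewrite oppr_eq0; case: eqP => // /eqP k0.
by rewrite -invr_expz fg// ?one_sub_eigenvalue// expfz_neq0// expf_neq0.
Qed.

Lemma Pzz_adj (X Y : psd) : pairing q (Pzz X) Y = pairing q X (Pzz Y).
Proof.
rewrite /Pzz pairingZl// pairingZr// [X in _ = _ * X]pairingC//.
by rewrite /pairing !ps1mul// mulrC.
Qed.

Lemma rmx_skew (X Y : psd) : pairing q (rmx X) Y = - pairing q X (rmx Y).
Proof.
rewrite /rmx !pairing_lin// /Pplus /Pminus !pairing_restr.
have -> : restr (fun i => 0 < - i) Y = restr (fun i => i < 0) Y.
  by apply/dseriesP => i /=; rewrite oppr_gt0.
have -> : restr (fun i => - i < 0) Y = restr (fun i => 0 < i) Y.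
  by apply/dseriesP => i /=; rewrite oppr_lt0.
by ring.
Qed.

(** The diagonal blocks are skew because hhat is orthogonal for the residue and
    (1 + x) / (1 - x) changes sign under inversion of x; the off-diagonal ones
    are adjoint to each other because inversion exchanges 1 / (1 - x) and
    - x / (1 - x), while the two components carry opposite signs. *)
Lemma Rmx_skew (X Y : psd * psd) :
  pairing2 q (Rmx q n X) Y = - pairing2 q X (Rmx q n Y).
Proof.
have adj_diag A B : pairing q (hfun0' q n (fun x => (1 + x) / (1 - x)) A) B =
    - pairing q A (hfun0' q n (fun x => (1 + x) / (1 - x)) B).
  apply: hfun0'_adj => x x0 x1.
  by field; rewrite x0 x1 -opprB oppr_eq0 x1.
have adj_off A B : pairing q (hfun0' q n (fun x => x / (1 - x)) A) B =
    - pairing q A (hfun0' q n (fun x => 1 / (1 - x)) B).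
  apply: hfun0'_adj => x x0 x1.
  by field; rewrite x0 x1 -opprB oppr_eq0 x1.
have adj_off' A B : pairing q (hfun0' q n (fun x => 1 / (1 - x)) A) B =
    - pairing q A (hfun0' q n (fun x => x / (1 - x)) B).
  by rewrite pairingC// [in RHS]pairingC// adj_off opprK.
case: X Y => X1 X2 [Y1 Y2]; rewrite /pairing2 /Rmx; cbn [fst snd].
(* The operators become variables because psscale, and with it the linearity of
   the form, would otherwise be found inside their definitions. *)
move: (rmx_skew X1 Y1) (rmx_skew X2 Y2) (adj_diag X1 Y1) (adj_diag X2 Y2).
move: (adj_off X2 Y1) (adj_off' X1 Y2) (Pzz_adj X1 Y2) (Pzz_adj X2 Y1).
move: (rmx X1) (rmx X2) (rmx Y1) (rmx Y2) (Pzz X1) (Pzz X2) (Pzz Y1) (Pzz Y2).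
move: (hfun0' q n _ X1) (hfun0' q n _ X2) (hfun0' q n _ Y1) (hfun0' q n _ Y2).
move: (hfun0' q n _ X1) (hfun0' q n _ X2) (hfun0' q n _ Y1) (hfun0' q n _ Y2).
move=> *; rewrite !pairing_lin//.
do 8!match goal with H : pairing q _ _ = _ |- _ => rewrite H; clear H end.
by ring.
Qed.

Lemma pairing2Dl (X X' Y : psd * psd) :
  pairing2 q (X + X') Y = pairing2 q X Y + pairing2 q X' Y.
Proof. by rewrite /pairing2 /= !pairingDl//; ring. Qed.

Lemma pairing2C (X Y : psd * psd) : pairing2 q X Y = pairing2 q Y X.
Proof. by rewrite /pairing2 !(pairingC q_neq0 X.1, pairingC q_neq0 X.2). Qed.

(** There are no terms of degree 0, hence r alone contributes. *)
Lemma Rmx_positive (X Y : psd) :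
  (forall i, i <= 0 -> X i = 0) -> (forall i, i <= 0 -> Y i = 0) ->
  Rmx q n (X, Y) = (psscale (1 / 2) X, psscale (1 / 2) Y).
Proof.
move=> X0 Y0; rewrite /Rmx /= !hfun0'E /Pzz !TrE X0// Y0//.
have r_pos (A : psd) : (forall i, i <= 0 -> A i = 0) ->
    rmx A = psscale (1 / 2) A.
  move=> A0; apply/dseriesP => i; apply/dseriesP => k /=.
  case: ltgtP => [i0|i0|<-]; first by rewrite subr0.
    by rewrite A0 ?ltW//= subr0 mulr0.
  by rewrite A0//= subr0.
rewrite !r_pos//; congr pair; apply/dseriesP => i; apply/dseriesP => k /=.
  by case: ifP => _ /=; rewrite !(mulr0, mul0r, oppr0, addr0).
by case: ifP => _ /=; rewrite !(mulr0, mul0r, oppr0, add0r, addr0).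
Qed.

(** On a pair of series without positive powers of D, whose terms of degree 0
    are related by hhat^n, the matrix acts as - 1/2 up to a multiple of (1, 1):
    in degree 0 the identities for x = q^(n k), k <> 0, are
    (1 + x) / (2 (1 - x)) x - x / (1 - x) = - x / 2 and
    x / (1 - x) - (1 + x) / (2 (1 - x)) = - 1 / 2,
    and for k = 0 only the terms with P_00 remain. *)
Lemma Rmx_nonpositive (X Y : psd) :
  (forall i, 0 < i -> X i = 0) -> (forall i, 0 < i -> Y i = 0) ->
  X 0 = hhat (q ^+ n) (Y 0) ->
  Rmx q n (X, Y) = (- psscale (1 / 2) X + psscale (Tr Y) (psone R),
                    - psscale (1 / 2) Y + psscale (Tr Y) (psone R)).
Proof.
move=> X0 Y0 XY; rewrite /Rmx /= !hfun0'E /Pzz !TrE /lint XY.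
have c0 : hhat (q ^+ n) (Y 0) 0 = Y 0 0 by rewrite /= expr0z mul1r.
congr pair; apply/dseriesP => i; apply/dseriesP => k /=; rewrite ?c0.
  case: (ltgtP i 0) => [i0|i0|->] /=.
  - by ring.
  - by rewrite X0//=; ring.
  rewrite XY /=; have [->|k0] := eqVneq k 0.
    by rewrite expr0z; field.
  move: (one_sub_eigenvalue k0); set x := _ ^ k => x1.
  by field; rewrite x1.
case: (ltgtP i 0) => [i0|i0|->] /=.
- by ring.
- by rewrite (Y0 i)//=; ring.
have [->|k0] := eqVneq k 0; first by rewrite ?expr0z; field.
move: (one_sub_eigenvalue k0); set x := _ ^ k => x1.
by field; rewrite x1.
Qed.

End RMatrix.

(** * The bracket on operators only sees the tangential part of a differential *)

Section BracketM.
Variable R : realType.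
Local Notation C := R[i].
Local Notation laurent := (laurent R).
Local Notation psd := (psd R).
Variables (q : C) (n : nat).
Hypotheses (q_gt0 : 0 < `|q|) (q_lt1 : `|q| < 1) (n_gt0 : (0 < n)%N).
Local Notation "A ** B" := (psmul q A B) (at level 40, left associativity).

Let q_neq0 : q != 0. Proof. by rewrite -normr_gt0. Qed.

Lemma pairing_swap (L A B : psd) :
  pairing q (L ** A) (L ** B) = pairing q (A ** L) (B ** L).
Proof. by rewrite pairing_cycle// psmulA// pairingA. Qed.

Lemma pairing_one_swap (L B : psd) :
  pairing q (psone R) (L ** B) = pairing q (psone R) (B ** L).
Proof. by rewrite /pairing !ps1mul//; exact: pairingC. Qed.

Lemma bracketM_antisym (L A B : psd) :
  bracketM q n L A B = - bracketM q n L B A.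
Proof. by rewrite /bracketM Rmx_skew// pairing2C. Qed.

Lemma bracketMDl (L A A' B : psd) :
  bracketM q n L (A + A') B = bracketM q n L A B + bracketM q n L A' B.
Proof.
have gradsD : gradsM q L (A + A') = gradsM q L A + gradsM q L A'.
  by rewrite /gradsM psmulDr psmulDl.
by rewrite /bracketM gradsD !Rmx_skew// pairing2Dl// opprD.
Qed.

Variable L : psd.
Hypothesis L_top : L n%:Z = 1.
Hypothesis L_gt : forall i, n%:Z < i -> L i = 0.
Hypothesis L_lt0 : forall i, i < 0 -> L i = 0.

(** For Z in J_+ both L Z and Z L are in J_+, where the matrix is 1/2, and
    Tr L Z L B = Tr Z L B L. *)
Lemma bracketM_positive (Z B : psd) :
  (forall i, i <= 0 -> Z i = 0) -> bracketM q n L Z B = 0.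
Proof.
move=> Z0; rewrite /bracketM /gradsM Rmx_positive => [|i i0|i i0].
- by rewrite /pairing2 /= !pairingZl// pairing_swap subrr.
- rewrite psmulE fsbig1// => j _; case: (ltP j 0) => [/L_lt0 ->|j0].
    by rewrite mul0r.
  by rewrite Z0 ?raddf0 ?mulr0//; lia.
- rewrite psmulE fsbig1// => j _; case: (leP j 0) => [/Z0 ->|j0].
    by rewrite mul0r.
  by rewrite L_lt0 ?raddf0 ?mulr0//; lia.
Qed.

(** If Z has order at most - n, then L Z and Z L have no positive powers of D,
    and their terms of degree 0 are hhat^n w and w for w = Z_(- n), because L is
    monic of order n. The matrix then acts as - 1/2 up to a multiple of (1, 1),
    and both parts pair trivially with (L B, B L). *)
Lemma bracketM_low (Z B : psd) :
  (forall i, - n%:Z < i -> Z i = 0) -> bracketM q n L Z B = 0.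
Proof.
move=> Z0; rewrite /bracketM /gradsM Rmx_nonpositive// => [|i i0|i i0|].
- rewrite /pairing2; cbn [fst snd]; rewrite !pairingDl// !pairingNl// !pairingZl//.
  by rewrite pairing_swap pairing_one_swap subrr.
- rewrite psmulE fsbig1// => j _; case: (ltP n%:Z j) => [/L_gt ->|jn].
    by rewrite mul0r.
  by rewrite Z0 ?raddf0 ?mulr0//; lia.
- rewrite psmulE fsbig1// => j _; case: (ltP (- n%:Z) j) => [/Z0 ->|jn].
    by rewrite mul0r.
  by rewrite L_gt ?raddf0 ?mulr0//; lia.
- rewrite !psmulE (@fsbigTE _ _ _ _ [fset n%:Z]%fset) => [|j]; last first.
    rewrite inE; case: ltgtP => // jn _; last by rewrite L_gt ?mul0r.
    by rewrite Z0 ?raddf0 ?mulr0//; lia.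
  rewrite (@fsbigTE _ _ _ _ [fset - n%:Z]%fset) => [|j]; last first.
    rewrite inE; case: ltgtP => // jn _; last by rewrite Z0 ?mul0r.
    by rewrite L_gt ?raddf0 ?mulr0//; lia.
  by rewrite !big_seq_fset1 !sub0r opprK L_top mul1r hhat1 mulr1 exprnP.
Qed.

(** A series that vanishes in the degrees from - n + 1 to 0 is the sum of one
    in J_+ and one of order at most - n. *)
Lemma bracketM_eql (A A' B : psd) :
  (forall i, - n%:Z < i <= 0 -> A i = A' i) ->
  bracketM q n L A B = bracketM q n L A' B.
Proof.
move=> AA'; pose Z := A - A'.
have -> : A = A' + (restr (fun i => 0 < i) Z + restr (fun i => i <= - n%:Z) Z).
  apply/dseriesP => i; rewrite !pcoefD /=.
  case: (ltP 0 i) => i0; first by rewrite ifF ?addr0 ?subrKC//; lia.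
  case: (leP i (- n%:Z)) => ni; first by rewrite add0r subrKC.
  by rewrite !addr0 AA'//; lia.
rewrite !bracketMDl [X in _ + (X + _)]bracketM_positive => [|i i0 /=].
  rewrite [X in _ + (_ + X)]bracketM_low ?addr0// => i i0 /=.
  by rewrite ifF//; lia.
by rewrite ifF//; lia.
Qed.

Lemma bracketM_eq (A A' B B' : psd) :
  (forall i, - n%:Z < i <= 0 -> A i = A' i) ->
  (forall i, - n%:Z < i <= 0 -> B i = B' i) ->
  bracketM q n L A B = bracketM q n L A' B'.
Proof.
move=> /bracketM_eql -> /bracketM_eql BB'.
by rewrite bracketM_antisym BB' -bracketM_antisym.
Qed.

End BracketM.

(** * Symbols, operators and their differentials *)

Section Differentials.
Variable R : realType.
Local Notation C := R[i].
Local Notation laurent := (laurent R).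
Local Notation psd := (psd R).
Variables (q : C) (n : nat).
Local Notation "A ** B" := (psmul q A B) (at level 40, left associativity).

Local Notation lower u := (\sum_(i < n) monom (n%:Z - i.+1%:Z) (u i) : psd).
Implicit Types (u v : 'I_n -> laurent) (T : psd).

Lemma lower_out u k : ~~ (0 <= k < n%:Z) -> (lower u) k = 0.
Proof.
move=> kn; rewrite coef_sum big1// => i _ /=; rewrite ifF//.
by apply: contraNF kn => /eqP ->; have := ltn_ord i; lia.
Qed.

Lemma lower_in u (i : 'I_n) : (lower u) (n%:Z - i.+1%:Z) = u i.
Proof.
rewrite coef_sum (bigD1 i)//= eqxx big1 ?addr0// => j ji; rewrite ifF//.
by apply: contraNF ji => /eqP e; apply/eqP/val_inj => /=; lia.
Qed.

(** Tangent vectors are the series supported in degrees 0 to n - 1. *)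
Lemma lowerP T : (forall k, ~~ (0 <= k < n%:Z) -> T k = 0) ->
  T = lower (fun i => T (n%:Z - i.+1%:Z)).
Proof.
move=> T0; apply/dseriesP => k.
have [kn|kn] := boolP (0 <= k < n%:Z); last by rewrite T0// lower_out.
have ltn : (n - `|k|.+1 < n)%N by lia.
have -> : k = n%:Z - (Ordinal ltn).+1%:Z by rewrite /=; lia.
by rewrite lower_in.
Qed.

Lemma Moperator_lt0 u i : i < 0 -> Moperator u i = 0.
Proof.
move=> i0; rewrite pcoefD lower_out ?addr0 /=; last by lia.
by rewrite ifF//; lia.
Qed.

Lemma Ghat_Moperator u : Ghat n (Moperator u).
Proof.
split=> [|i ni]; rewrite pcoefD lower_out ?addr0/= ?eqxx//; try lia.
by rewrite ifF//; lia.
Qed.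

Lemma Gsymbol_Moperator u : Gsymbol q u = Moperator u.
Proof.
apply/dseriesP => k; rewrite psmul_Dpowr !pcoefD !coef_sum /= subr_eq0.
congr (_ + _); apply: eq_bigr => i _ /=; congr (if _ then _ else _).
by lia.
Qed.

Lemma Moperator_line u v (t : C) :
  Moperator u + psscale t (lower v) =
  Moperator (fun i => u i + lscale (fun=> t) (v i)).
Proof.
rewrite -addrA; congr (_ + _); apply/dseriesP => k; rewrite pcoefD.
have [kn|kn] := boolP (0 <= k < n%:Z); last first.
  rewrite [psscale _ _ k]/= !lower_out// add0r; exact: raddf0.
have ltn : (n - `|k|.+1 < n)%N by lia.
have -> : k = n%:Z - (Ordinal ltn).+1%:Z by rewrite /=; lia.
by rewrite [psscale _ _ _](congr1 (lscale (fun=> t)) (lower_in _ _)) !lower_in.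
Qed.

Lemma derivative_at0_unique (f : R -> C) (a b : C) :
  derivative_at0 f a -> derivative_at0 f b -> a = b.
Proof.
move=> [ar ai] [br bi]; apply/eqP; rewrite eq_complex.
rewrite -(@derive_val _ _ _ _ _ _ _ ar) -(@derive_val _ _ _ _ _ _ _ ai).
by rewrite (@derive_val _ _ _ _ _ _ _ br) (@derive_val _ _ _ _ _ _ _ bi) !eqxx.
Qed.

Lemma psmul_DpowK T (m : int) : T ** Dpow R (- m) ** Dpow R m = T.
Proof. by apply/dseriesP => k; rewrite !psmul_Dpowr; congr (T _); lia. Qed.

Definition nonneg_part : psd -> psd := restr (fun i => 0 <= i).

Lemma Ghat_nonneg_part (L : psd) : Ghat n L -> Mset n (nonneg_part L).
Proof.
move=> [L1 Lgt]; pose T := nonneg_part L - Dpow R n%:Z.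
exists (fun i : 'I_n => T (n%:Z - i.+1%:Z)) => //.
rewrite /Moperator -lowerP ?subrKC// => k kn; rewrite pcoefD pcoefN /=.
have [->|kn'] := eqVneq k n%:Z; first by rewrite L1 subrr.
by case: ifP => k0; rewrite ?subr0// Lgt//; lia.
Qed.

Hypothesis q_neq0 : q != 0.

(** With d = D^n d' both gradients of a symbol become those of an operator:
    (L D^(- n)) D^n d' = L d' and D^(- n) D^n d' (L D^(- n)) D^n = d' L. *)
Lemma gradsGE (L d : psd) :
  gradsG q n L d = gradsM q L (Dpow R (- n%:Z) ** d).
Proof.
rewrite /gradsG /gradsM /Lbar; congr pair; first by rewrite psmulA.
by rewrite [X in X ** _]psmulA// psmul_DpowK.
Qed.

(** Along a line in the affine space of operators an extension and the original
    functional are the same function, so that their differentials have the same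
    pairing with every tangent vector; these vectors detect exactly the
    coefficients of D^i with - n < i <= 0. *)
Lemma grad_agree (Phi phi : psd -> C) u (dPhi dphi : psd) :
  extends q n Phi phi ->
  is_gradG q n Phi (Gsymbol q u) dPhi ->
  is_gradM q n phi (Moperator u) dphi ->
  forall i, - n%:Z < i <= 0 -> (Dpow R (- n%:Z) ** dPhi) i = dphi i.
Proof.
move=> ext gG gM i ni; apply/eqP; rewrite -subr_eq0; apply/eqP.
apply: (@pairing_nondegenerate _ q q_neq0 (Dpow R (- n%:Z) ** dPhi - dphi)) => a.
have Te : monom (- i) a = lower (fun j => monom (- i) a (n%:Z - j.+1%:Z)).
  by apply: lowerP => k kn /=; rewrite ifF//; lia.
rewrite pairingDl// pairingNl// [X in X - _]pairingC// -pairingA//.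
apply/eqP; rewrite subr_eq0; apply/eqP.
apply: (@derivative_at0_unique (fun t : R =>
  phi (Moperator u + psscale t%:C%C (monom (- i) a)))).
  have /gG : Jminus (monom (- i) a ** Dpow R (- n%:Z)).
    by move=> k k0; rewrite psmul_Dpowr /= ifF//; lia.
  rewrite psmul_DpowK Gsymbol_Moperator.
  congr derivative_at0; apply/funext => t.
  by rewrite Te Moperator_line -ext Gsymbol_Moperator.
by apply: gM; exists (fun j => monom (- i) a (n%:Z - j.+1%:Z)).
Qed.

(** A functional of operators extends to symbols by forgetting the negative
    powers of D. If d is a differential of phi, then D^n d_- is one of the
    extension, where d_- consists of the terms of d of degree at most 0: these
    are the ones paired with the terms of degree at least 0. *)
Lemma nonneg_part_smooth (phi : psd -> C) :
  smoothM q n phi -> smoothG q n (fun L => phi (nonneg_part L)).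
Proof.
move=> phi_smooth L /Ghat_nonneg_part/phi_smooth[d dP].
exists (Dpow R n%:Z ** restr (fun i => i <= 0) d) => X X_neg.
have TX : Mtangent n (nonneg_part (X ** Dpow R n%:Z)).
  exists (fun i => nonneg_part (X ** Dpow R n%:Z) (n%:Z - i.+1%:Z)).
  apply: lowerP => k kn; rewrite [LHS]/=; case: ifP => // k0.
  by rewrite -[LHS]/((X ** Dpow R n%:Z) k) psmul_Dpowr X_neg//; lia.
have -> : pairing q X (Dpow R n%:Z ** restr (fun i => i <= 0) d) =
    pairing q d (nonneg_part (X ** Dpow R n%:Z)).
  rewrite -pairingA// pairingC// pairing_restr; congr pairing.
  by apply/dseriesP => k /=; rewrite oppr_le0.
congr derivative_at0: (dP _ TX); apply/funext => t; congr phi.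
apply/dseriesP => k; rewrite !pcoefD [in RHS]/=.
by rewrite [in LHS]/=; case: ifP => // _; rewrite raddf0 addr0.
Qed.

End Differentials.

(** * Comparison of the two brackets *)

Theorem mainTheorem6 (R : realType) (q : R[i]) (q_gt0 : 0 < `|q|)
    (q_lt1 : `|q| < 1) (n : nat) (n_gt0 : (0 < n)%N) :
  [/\ forall u : 'I_n -> laurent R,
        Ghat n (Gsymbol q u) /\ Gsymbol q u = Moperator u,
      forall phi : psd R -> R[i], smoothM q n phi ->
        exists2 Phi : psd R -> R[i], smoothG q n Phi & extends q n Phi phi
    & forall phi psi Phi Psi : psd R -> R[i],
        smoothM q n phi -> smoothM q n psi ->
        smoothG q n Phi -> smoothG q n Psi ->
        extends q n Phi phi -> extends q n Psi psi ->
        forall (u : 'I_n -> laurent R) (dPhi dPsi dphi dpsi : psd R),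
          is_gradG q n Phi (Gsymbol q u) dPhi ->
          is_gradG q n Psi (Gsymbol q u) dPsi ->
          is_gradM q n phi (Moperator u) dphi ->
          is_gradM q n psi (Moperator u) dpsi ->
          bracketG q n (Gsymbol q u) dPhi dPsi =
          bracketM q n (Moperator u) dphi dpsi].
Proof.
have q_neq0 : q != 0 by rewrite -normr_gt0.
split=> [u|phi phi_smooth|phi psi Phi Psi _ _ _ _ extPhi extPsi].
- by rewrite Gsymbol_Moperator; split=> //; exact: Ghat_Moperator.
- exists (fun L => phi (nonneg_part L)).
    exact: nonneg_part_smooth.
  move=> u; rewrite Gsymbol_Moperator; congr phi.
  apply/dseriesP => k /=; case: ltP => // k0.
  by rewrite [RHS]Moperator_lt0.
move=> u dPhi dPsi dphi dpsi gPhi gPsi gphi gpsi.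
have [u_top u_gt] := Ghat_Moperator u.
rewrite /bracketG !gradsGE// [in LHS]Gsymbol_Moperator.
apply: (bracketM_eq q_gt0 q_lt1 n_gt0 u_top u_gt) => [i|i|i].
- exact: Moperator_lt0.
- exact: (grad_agree q_neq0 extPhi gPhi gphi).
- exact: (grad_agree q_neq0 extPsi gPsi gpsi).
Qed.
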